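(* If $G$ is a compactly covered locally compact topologically quasihamiltonian group, then $h_{alg}(id_G)=0$, where $id_G$ is the identity map of $G$.
   Context: All topological groups are Hausdorff. A topological group is compactly covered if each of its elements lies in a compact subgroup. A closed subgroup $N$ of a topological group $G$ is topologically quasinormal if $\overline{NL}=\overline{LN}$ for every closed subgroup $L$ of $G$; $G$ is topologically quasihamiltonian if every closed subgroup of $G$ is topologically quasinormal. Algebraic entropy: let $G$ be a locally compact group with right Haar measure $\mu$ and $\phi$ a continuous endomorphism of $G$. For $U\subseteq G$ and $n\geq 1$ put $T_n(\phi,U)=U\cdot\phi(U)\cdots\phi^{n-1}(U)$. For $U$ a compact neighborhood of $e_G$ put $H_{alg}(\phi,U)=\limsup_{n\to\infty}\frac{\log\mu(T_n(\phi,U))}{n}$, and let $h_{alg}(\phi)\in[0,\infty]$ be the supremum of $H_{alg}(\phi,U)$ over all compact neighborhoods $U$ of $e_G$. *)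

(* Defs.v *)
From HB Require Import structures.
From mathcomp Require Import all_boot all_order all_algebra.
From mathcomp Require Import all_classical all_reals all_analysis.

Set Implicit Arguments.
Unset Strict Implicit.
Unset Printing Implicit Defensive.

Import Order.TTheory GRing.Theory Num.Theory.
Import numFieldNormedType.Exports.

Local Open Scope classical_set_scope.
Local Open Scope ring_scope.

(* Multiplicative, possibly infinite and non-abelian, counterpart of
   topologicalZmodType. The distinguished point of the pointed structure is
   arbitrary and plays no role; g_sigma_algebraType asks for it. Hausdorffness
   is not part of the structure. *)
HB.mixin Record isTopologicalGroup G & PointedTopological G & Group G := {
  mulg_continuous : continuous (fun x : G * G => (x.1 * x.2)%g) ;
  invg_continuous : continuous (fun x : G => (x^-1)%g)
}.

#[short(type="topologicalGroupType")]
HB.structure Definition TopologicalGroup :=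
  {G of isTopologicalGroup G & PointedTopological G & Group G}.

Definition setmulg {G : groupType} (A B : set G) : set G :=
  [set (a * b)%g | a in A & b in B].

Definition is_subgroup {G : groupType} (H : set G) : Prop :=
  group_closed (mem H).

Section QuasiHamiltonian.
Context {G : topologicalGroupType}.

Definition closed_subgroup (H : set G) : Prop := is_subgroup H /\ closed H.

Definition compact_subgroup (H : set G) : Prop := is_subgroup H /\ compact H.

Definition top_quasinormal (N : set G) : Prop :=
  closed_subgroup N /\
  forall L : set G, closed_subgroup L ->
    closure (setmulg N L) = closure (setmulg L N).

End QuasiHamiltonian.

Definition top_quasihamiltonian (G : topologicalGroupType) : Prop :=
  forall N : set G, closed_subgroup N -> top_quasinormal N.

Definition compactly_covered (G : topologicalGroupType) : Prop :=
  forall x : G, exists2 K : set G, compact_subgroup K & K x.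

(* G with its Borel sigma-algebra. *)
Notation borelType G := (g_sigma_algebraType (@open G)).

Section Haar.
Context {R : realType} {G : topologicalGroupType}.
Local Open Scope ereal_scope.

(* Nonzero Radon measure on the Borel sets (finite on compact sets, outer
   regular on Borel sets, inner regular on open sets), invariant under right
   translations. *)
Record right_haar_measure (mu : {measure set (borelType G) -> \bar R}) :
    Prop := RightHaarMeasure {
  haar_neq0 : mu setT != 0 ;
  haar_compact_fin : forall K : set G, compact K -> mu K < +oo ;
  haar_outer_regular : forall A : set G, measurable (A : set (borelType G)) ->
    mu A = ereal_inf [set mu V | V in [set V : set G | open V /\ A `<=` V]] ;
  haar_inner_regular : forall V : set G, open V ->
    mu V = ereal_sup [set mu K | K in [set K : set G | compact K /\ K `<=` V]] ;
  haar_right_invariant : forall (A : set G) (g : G),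
    measurable (A : set (borelType G)) ->
    mu [set (a * g)%g | a in A] = mu A
}.

End Haar.

Section AlgebraicEntropy.
Context {R : realType} {G : topologicalGroupType}.
Variables (mu : {measure set (borelType G) -> \bar R}) (phi : G -> G).
Local Open Scope ereal_scope.

(* T_n(phi, U) = U . phi(U) ... phi^{n-1}(U). The value {1} at n = 0 is a
   convention without influence on the limsup below. *)
Definition alg_trajectory (U : set G) (n : nat) : set G :=
  \big[setmulg/[set 1%g]]_(i < n) (iter i phi @` U).

Definition H_alg (U : set G) : \bar R :=
  limn_esup (fun n : nat => lne (mu (alg_trajectory U n)) * (n%:R^-1)%:E).

Definition h_alg : \bar R :=
  ereal_sup [set H_alg U | U in [set U : set G | compact U /\ nbhs 1%g U]].

End AlgebraicEntropy.

(* Main.v *)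
Require Import Defs.
From HB Require Import structures.
From mathcomp Require Import all_boot all_order all_algebra.
From mathcomp Require Import all_classical all_reals all_analysis.

(** The entropy vanishes because the powers of a compact neighborhood [U] of
    the identity all stay inside one fixed compact set.

    The set [U U] is compact, so finitely many right translates of [U] cover
    it: [U U `<=` U F] with [F] finite. Each element of [F] lies in a compact
    subgroup, and the product of two compact subgroups [N], [L] is again a
    compact subgroup: [N L] and [L N] are compact, hence closed, so topological
    quasinormality says [N L = L N]. Therefore [F] lies in a compact subgroup
    [K], and [U (U K) = (U U) K `<=` U F K `<=` U K] shows by induction that
    [U^n `<=` U K] for every [n].

    For [n >= 1] the measure of [U^n] thus lies between [mu U] and [mu (U K)].
    The latter is finite by compactness; the former is positive, since
    otherwise finitely many null translates of [U] would cover each compact set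
    and the measure would vanish by inner regularity. So [log (mu (U^n)) / n]
    is squeezed between two sequences that tend to [0]. *)

Import Order.TTheory GRing.Theory Num.Theory.
Import numFieldNormedType.Exports.

Local Open Scope classical_set_scope.
Local Open Scope ring_scope.
Local Open Scope ereal_scope.

(** * Products of subsets of a group *)

Lemma setmulgS {G : groupType} (A B C D : set G) :
  A `<=` C -> B `<=` D -> setmulg A B `<=` setmulg C D.
Proof.
move=> AC BD _ [a Aa [b Bb <-]].
by exists a; [exact: AC | exists b; [exact: BD |]].
Qed.

Lemma setmulgA {G : groupType} (A B C : set G) :
  setmulg A (setmulg B C) = setmulg (setmulg A B) C.
Proof.
apply/seteqP; split=> [_ [a Aa [_ [b Bb [c Cc <-]] <-]]|].
  by rewrite mulgA; exists (a * b)%g; [exists a => //; exists b | exists c].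
move=> _ [_ [a Aa [b Bb <-]] [c Cc <-]].
rewrite -mulgA; exists a => //; exists (b * c)%g => //.
by exists b => //; exists c.
Qed.

Section Subgroups.
Context {G : groupType} {H : set G}.
Hypothesis sgH : is_subgroup H.

Lemma subgroup1 : H 1%g.
Proof. by case: sgH => /set_mem. Qed.

Lemma subgroupM (x y : G) : H x -> H y -> H (x * y)%g.
Proof.
move=> Hx Hy; apply: set_mem.
by apply: (group_closedM sgH); exact: mem_set.
Qed.

Lemma subgroupV (x : G) : H x -> H (x^-1)%g.
Proof.
by move=> Hx; apply: set_mem; apply: (group_closedV sgH); exact: mem_set.
Qed.

Lemma setmulg_subgroup : setmulg H H `<=` H.
Proof. by move=> _ [x Hx [y Hy <-]]; exact: subgroupM. Qed.

End Subgroups.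

Lemma subgroup_setmulg {G : groupType} (N L : set G) :
  is_subgroup N -> is_subgroup L -> setmulg N L = setmulg L N ->
  is_subgroup (setmulg N L).
Proof.
move=> sN sL NL.
split=> [|x y /set_mem[n Nn [l Ll <-]] /set_mem[m Nm [k Lk <-]]].
  apply/mem_set; exists 1%g; first exact: subgroup1.
  by exists 1%g; [exact: subgroup1 | rewrite mulg1].
apply/mem_set.
(* [(n l) (m k)^-1 = n ((l k^-1) m^-1)], and the right factor, an element of
   [L N], can be rewritten with its factor from [N] in front. *)
have LN : setmulg L N ((l * k^-1) * m^-1)%g.
  exists (l * k^-1)%g; first by apply: subgroupM => //; exact: subgroupV.
  by exists (m^-1)%g => //; exact: subgroupV.
move: LN; rewrite -NL => -[n' Nn' [l' Ll' e]].
exists (n * n')%g; first exact: subgroupM.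
by exists l' => //; rewrite -mulgA e invgM !mulgA.
Qed.

(** * Compact sets and compact subgroups of a topological group *)

Section TopologicalGroup.
Context {G : topologicalGroupType}.

Lemma mulgr_continuous (g : G) : continuous (fun x : G => (x * g)%g).
Proof.
move=> x; apply: (@continuous_comp _ _ _ (fun y : G => (y, g))
  (fun p : G * G => (p.1 * p.2)%g)); last exact: mulg_continuous.
by apply: cvg_pair; [exact: cvg_id | exact: cvg_cst].
Qed.

Lemma compact_setmulg (A B : set G) :
  compact A -> compact B -> compact (setmulg A B).
Proof.
move=> cA cB.
have -> : setmulg A B = (fun p : G * G => (p.1 * p.2)%g) @` (A `*` B).
  apply/seteqP; split=> [_ [a Aa [b Bb <-]]|_ [[a b] [/= Aa Bb] <-]].
    by exists (a, b).
  by exists a => //; exists b.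
apply: continuous_compact; last exact: compact_setX.
by apply: continuous_subspaceT; exact: mulg_continuous.
Qed.

Lemma right_translateE (A : set G) (g : G) :
  [set (a * g)%g | a in A] = (fun x : G => (x * g^-1)%g) @^-1` A.
Proof.
apply/seteqP; split=> [_ [a Aa <-]|x /= Axg]; first by rewrite /= mulgK.
by exists (x * g^-1)%g => //; rewrite mulgVK.
Qed.

Lemma open_right_translate (A : set G) (g : G) :
  open A -> open [set (a * g)%g | a in A].
Proof.
move=> oA; rewrite right_translateE; apply: open_comp => // x _.
exact: mulgr_continuous.
Qed.

Lemma compact_right_translates (C U : set G) : compact C -> nbhs 1%g U ->
  exists s : seq G, forall x, C x ->
    exists2 g, g \in s & [set (a * g)%g | a in U°] x.
Proof.
move=> cC U1; move: cC; rewrite compact_cover.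
move=> /(_ G setT (fun g => [set (a * g)%g | a in U°])) [].
- by move=> g _; apply: open_right_translate; exact: open_interior.
- move=> x _; exists x => //; exists 1%g; last by rewrite mul1g.
  by rewrite /interior.
- move=> D _ CD; exists (finmap.enum_fset D) => x /CD [g Dg Ugx].
  by exists g.
Qed.

Hypothesis hausG : hausdorff_space G.

(** Both products are compact, hence closed, so that the closures in the
    definition of topological quasinormality disappear: [N] and [L] permute. *)
Lemma compact_subgroup_setmulg (N L : set G) : top_quasinormal N ->
  compact_subgroup N -> compact_subgroup L -> compact_subgroup (setmulg N L).
Proof.
move=> [_ qN] [sN cN] [sL cL].
have closedM (A B : set G) : compact A -> compact B ->
    closure (setmulg A B) = setmulg A B.
  move=> cA cB; apply/esym/closure_id; apply: compact_closed => //.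
  exact: compact_setmulg.
split; last exact: compact_setmulg.
apply: subgroup_setmulg => //.
rewrite -[LHS]closedM// -[RHS]closedM//; apply: qN.
by split => //; exact: compact_closed.
Qed.

(** The factors of a product of compact subgroups are contained in it, so the
    compact subgroups that cover the single points can be multiplied together. *)
Lemma finite_sub_compact_subgroup (s : seq G) :
  compactly_covered G -> top_quasihamiltonian G ->
  exists2 K : set G, compact_subgroup K & forall x, x \in s -> K x.
Proof.
move=> ccG qhG; elim: s => [|x s [K cK sK]].
  by have [K cK _] := ccG 1%g; exists K.
have [N cN Nx] := ccG x; exists (setmulg N K).
  apply: compact_subgroup_setmulg => //; apply: qhG.
  by case: cN => sN cN; split => //; exact: compact_closed.
move=> y; rewrite inE => /orP[/eqP ->|/sK Ky].
  by exists x => //; exists 1%g; [exact: (subgroup1 cK.1) | rewrite mulg1].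
by exists 1%g; [exact: (subgroup1 cN.1) | exists y => //; rewrite mul1g].
Qed.

End TopologicalGroup.

(** * Trajectories of the identity map *)

Section IdentityTrajectory.
Context {G : topologicalGroupType}.

Lemma alg_trajectory_id0 (U : set G) : alg_trajectory id U 0 = [set 1%g].
Proof. by rewrite /alg_trajectory big_ord0. Qed.

Lemma alg_trajectory_idS (U : set G) (n : nat) :
  alg_trajectory id U n.+1 = setmulg U (alg_trajectory id U n).
Proof. by rewrite /alg_trajectory big_ord_recl /= image_id. Qed.

Lemma compact_alg_trajectory_id (U : set G) (n : nat) :
  compact U -> compact (alg_trajectory id U n).
Proof.
move=> cU; elim: n => [|n IH].
  by rewrite alg_trajectory_id0; exact: compact_set1.
by rewrite alg_trajectory_idS; exact: compact_setmulg.
Qed.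

Lemma alg_trajectory_id1 (U : set G) (n : nat) :
  U 1%g -> alg_trajectory id U n 1%g.
Proof.
move=> U1; elim: n => [|n IH]; first by rewrite alg_trajectory_id0.
rewrite alg_trajectory_idS; exists 1%g => //.
by exists 1%g => //; rewrite mulg1.
Qed.

Lemma sub_alg_trajectory_id (U : set G) (n : nat) :
  U 1%g -> U `<=` alg_trajectory id U n.+1.
Proof.
move=> U1 u Uu; rewrite alg_trajectory_idS; exists u => //; exists 1%g.
  exact: alg_trajectory_id1.
by rewrite mulg1.
Qed.

(** Finitely many right translates [U g] cover [U U], and a compact subgroup
    [K] containing these [g] absorbs them: [U (U K) `<=` U K]. *)
Lemma alg_trajectory_id_bounded (U : set G) :
  hausdorff_space G -> compactly_covered G -> top_quasihamiltonian G ->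
  compact U -> nbhs 1%g U ->
  exists2 C : set G, compact C & forall n, alg_trajectory id U n `<=` C.
Proof.
move=> hG ccG qhG cU nU.
have [s UUs] := compact_right_translates _ _ (compact_setmulg _ _ cU cU) nU.
have [K [sK cK] Ks] := finite_sub_compact_subgroup hG s ccG qhG.
have UUK : setmulg U U `<=` setmulg U K.
  move=> x /UUs [g /Ks Kg [u /interior_subset Uu <-]].
  by exists u => //; exists g.
exists (setmulg U K); first exact: compact_setmulg.
elim=> [|n IH].
  rewrite alg_trajectory_id0 => _ ->.
  exists 1%g; first exact: nbhs_singleton.
  by exists 1%g; [exact: subgroup1 | rewrite mulg1].
rewrite alg_trajectory_idS.
apply: subset_trans (setmulgS _ _ _ _ (@subset_refl _ U) IH) _.
rewrite setmulgA; apply: subset_trans (setmulgS _ _ _ _ UUK (@subset_refl _ K)) _.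
rewrite -setmulgA; apply: setmulgS => //.
exact: setmulg_subgroup.
Qed.

End IdentityTrajectory.

(** * Positivity of Haar measure *)

Section Haar.
Context {R : realType} {G : topologicalGroupType}.
Context {mu : {measure set (borelType G) -> \bar R}}.
Hypothesis haar : right_haar_measure mu.

Lemma open_borel (A : set G) : open A -> measurable (A : set (borelType G)).
Proof. by move=> oA; exact: sub_sigma_algebra. Qed.

Lemma compact_borel (A : set G) : hausdorff_space G -> compact A ->
  measurable (A : set (borelType G)).
Proof.
move=> hG cA; rewrite -[A]setCK; apply: measurableC; apply: open_borel.
by rewrite openC; exact: compact_closed.
Qed.

(** If the interior of [U] were null, then so would be its right translates,
    every compact set, and finally the whole group. *)
Lemma haar_interior_gt0 (U : set G) :
  hausdorff_space G -> nbhs 1%g U -> 0 < mu U°.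
Proof.
move=> hG nU; rewrite lt0e measure_ge0 andbT; apply/eqP => U0.
have oT g : measurable ([set (a * g)%g | a in U°] : set (borelType G)).
  by apply: open_borel; apply: open_right_translate; exact: open_interior.
have null (C : set G) : compact C -> mu C = 0.
  move=> cC; have [s Cs] := compact_right_translates _ _ cC nU.
  apply/eqP; rewrite eq_le measure_ge0 andbT.
  have -> : 0 = \sum_(g \in [set` s]) mu [set (a * g)%g | a in U°].
    rewrite fsbig1// => g _; rewrite (haar_right_invariant haar) ?U0//.
    by apply: open_borel; exact: open_interior.
  apply: content_sub_fsum => //; [exact: finite_seq | exact: compact_borel].
move/eqP: (haar_neq0 haar); apply.
rewrite (haar_inner_regular haar openT).
apply/eqP; rewrite eq_le; apply/andP; split.
  by apply: ge_ereal_sup => _ [K [cK _] <-]; rewrite null.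
apply: ereal_sup_ubound; exists set0; last exact: measure0.
by split => //; exact: compact0.
Qed.

End Haar.

(** * Entropy of the identity map *)

Lemma cvg_inv_natZl {R : realType} (x : \bar R) : x \is a fin_num ->
  (fun n : nat => x * (n%:R^-1)%:E) @ \oo --> 0.
Proof.
move=> xfin; rewrite -(mule0 x); apply: cvgeZl => //.
apply: cvg_EFin; first by near=> n.
rewrite -cvg_shiftS; exact: cvg_harmonic.
Unshelve. all: by end_near. Qed.

Lemma lne_fin_num {R : realType} (x : \bar R) :
  0 < x -> x < +oo -> lne x \is a fin_num.
Proof. by case: x => [r| |]//; rewrite lte_fin => r0 _; rewrite lne_EFin. Qed.

Lemma H_alg_id {R : realType} {G : topologicalGroupType}
    {mu : {measure set (borelType G) -> \bar R}} (U : set G) :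
  hausdorff_space G -> compactly_covered G -> top_quasihamiltonian G ->
  right_haar_measure mu -> compact U -> nbhs 1%g U -> H_alg mu id U = 0.
Proof.
move=> hG ccG qhG haar cU nU.
have [C cC TC] := alg_trajectory_id_bounded U hG ccG qhG cU nU.
have U1 : U 1%g by exact: nbhs_singleton.
have mT n : measurable (alg_trajectory id U n : set (borelType G)).
  by apply: compact_borel => //; exact: compact_alg_trajectory_id.
have mU : measurable (U : set (borelType G)) by exact: compact_borel.
have mC : measurable (C : set (borelType G)) by exact: compact_borel.
have muU : 0 < mu U.
  apply: lt_le_trans (haar_interior_gt0 haar U hG nU) _.
  apply: le_measure; rewrite ?inE//; last exact: interior_subset.
  by apply: open_borel; exact: open_interior.
have UT n : mu U <= mu (alg_trajectory id U n.+1).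
  by apply: le_measure; rewrite ?inE//; exact: sub_alg_trajectory_id.
have muTC n : mu (alg_trajectory id U n) <= mu C.
  by apply: le_measure; rewrite ?inE//; exact: TC.
have muUC : mu U <= mu C := le_trans (UT 0%N) (muTC 1%N).
have muC : mu C < +oo := haar_compact_fin haar cC.
have pos (x : \bar R) : 0 <= x -> x \in `[0, +oo].
  by move=> x0; rewrite in_itv /= x0 leey.
apply: (cvg_limn_einf_sup _).2.
apply: (squeeze_cvge (f := fun n => lne (mu U) * (n%:R^-1)%:E)
                     (h := fun n => lne (mu C) * (n%:R^-1)%:E)).
- near=> n.
  have n0 : (0 < n)%N by near: n; exact: nbhs_infty_gt.
  have UTn : mu U <= mu (alg_trajectory id U n) by rewrite -(prednK n0).
  by apply/andP; split; apply: lee_wpmul2r; rewrite ?lee_fin ?invr_ge0//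
    lee_lne// pos.
- apply: cvg_inv_natZl; apply: lne_fin_num => //; exact: le_lt_trans muC.
- apply: cvg_inv_natZl; apply: lne_fin_num => //; exact: lt_le_trans muUC.
Unshelve. all: by end_near. Qed.

Theorem lemma4p1 (R : realType) (G : topologicalGroupType)
    (mu : {measure set (borelType G) -> \bar R})
    (hG : hausdorff_space G)
    (lcG : locally_compact [set: G])
    (ccG : compactly_covered G)
    (qhG : top_quasihamiltonian G)
    (haar : right_haar_measure mu) :
  h_alg mu (@id G) = 0.
Proof.
(* Local compactness makes the supremum range over a nonempty family. *)
have [U nU [cU _]] := lcG 1%g Logic.I.
have {}nU : nbhs (1%g : G) (fun x => [set: G] x -> U x) := nU.
have {}nU : nbhs (1%g : G) U by apply: filterS nU => x; exact.
apply/eqP; rewrite eq_le; apply/andP; split.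
  by apply: ge_ereal_sup => _ [V [cV nV] <-]; rewrite H_alg_id.
by apply: ereal_sup_ubound; exists U => //; exact: H_alg_id.
Qed.
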